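(* (Class Ib solutions.) Let $B\neq0$, $D>0$, $R>0$, $F$, $C$ be real constants, set $\Phi(r)=F-DR^2\left(1-\frac{r^2}{R^2}\right)^{1/2}$ and $e^{-\alpha}=1-\frac{r^2}{R^2}$, and let $I\subset(0,R)$ be an open interval on which the expressions below are defined and $e^{\omega}>0$. Each of the following is a solution on $I$ of the static spherically symmetric Einstein–Maxwell perfect fluid equations, with $\kappa\rho+\frac{Q^2}{r^4}=\frac3{R^2}$ and with electric potential $\phi$ satisfying $Ae^{\omega}=B+(C+\phi)^2$ for the indicated value of $A$. (1) $A=\frac12$: $e^{\omega}=2B\cosh^2\left[\frac{\Phi}{\sqrt2}\right]$ if $B>0$, $e^{\omega}=-2B\sinh^2\left[\frac{\Phi}{\sqrt2}\right]$ if $B<0$; $Q=\pm\frac{Dr^3}{2}$; $\kappa\rho=\frac3{R^2}-\frac{D^2r^2}4$; $$\kappa p=-\frac1{R^2}+\frac{D^2r^2}{4}+\sqrt2\,D\left(1-\frac{r^2}{R^2}\right)^{1/2}\cdot\begin{cases}\tanh\left[\frac{\Phi}{\sqrt2}\right],&B>0,\\ \coth\left[\frac{\Phi}{\sqrt2}\right],&B<0.\end{cases}$$ (2) $A=1$, $B>0$: $e^{\omega}=B\coth^2[\sqrt B\,\Phi]$; $Q=\pm\sqrt B\,Dr^3\operatorname{csch}[\sqrt B\,\Phi]$; $\kappa\rho=\frac3{R^2}-BD^2r^2\operatorname{csch}^2[\sqrt B\,\Phi]$; $$\kappa p=-\frac1{R^2}+BD^2r^2\operatorname{csch}^2[\sqrt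 B\,\Phi]-2\sqrt B\,D\operatorname{sech}[\sqrt B\,\Phi]\operatorname{csch}[\sqrt B\,\Phi]\left(1-\frac{r^2}{R^2}\right)^{1/2}.$$ (3) $A=1$, $B<0$: $e^{\omega}=-B\tan^2[\sqrt{-B}\,\Phi]$; $Q=\pm\sqrt{-B}\,Dr^3\sec[\sqrt{-B}\,\Phi]$; $\kappa\rho=\frac3{R^2}+BD^2r^2\sec^2[\sqrt{-B}\,\Phi]$; $$\kappa p=-\frac1{R^2}-BD^2r^2\sec^2[\sqrt{-B}\,\Phi]+2\sqrt{-B}\,D\sec[\sqrt{-B}\,\Phi]\csc[\sqrt{-B}\,\Phi]\left(1-\frac{r^2}{R^2}\right)^{1/2}.$$ (4) $A=\frac32$: $e^{\omega}=\frac{2B^3\Phi^2}{3B^2\Phi^2-2}$; $Q=\pm\frac{3DBr^3}{3B^2\Phi^2-2}$; $\kappa\rho=\frac3{R^2}-\frac{9B^2D^2r^2}{(3B^2\Phi^2-2)^2}$; $$\kappa p=-\frac1{R^2}+\frac{9B^2D^2r^2}{(3B^2\Phi^2-2)^2}-\frac{4D\left(1-\frac{r^2}{R^2}\right)^{1/2}}{(3B^2\Phi^2-2)\Phi}.$$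
   Context: The metric is $ds^2=e^{\alpha(r)}dr^2+r^2(d\theta^2+\sin^2\theta\,d\varphi^2)-e^{\omega(r)}dt^2$, $p$ and $\rho$ are the (isotropic) matter pressure and density, $\phi(r)$ is the electric potential, $Q(r)=r^2\phi'e^{-\frac12(\alpha+\omega)}$ is the charge inside radius $r$, $\kappa>0$ is a constant and $'=d/dr$. The static spherically symmetric Einstein–Maxwell perfect fluid equations are $$\kappa p-\frac{Q^2}{r^4}=-\frac1{r^2}+\frac{e^{-\alpha}}{r^2}(1+r\omega'),$$ $$\kappa p+\frac{Q^2}{r^4}=e^{-\alpha}\left(\tfrac12\omega''-\tfrac14\alpha'\omega'+\tfrac14\omega'^2+\frac{\omega'-\alpha'}{2r}\right),$$ $$\kappa\rho+\frac{Q^2}{r^4}=\frac1{r^2}-\frac{e^{-\alpha}}{r^2}(1-r\alpha').$$ The sign $\pm$ in $Q$ corresponds to the choice of root $\phi=-C\pm\sqrt{Ae^{\omega}-B}$ of the functional relation: for each choice of root, $Q$ is given by the stated formula with one of the two signs. *)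

(* Defs.v *)
From Stdlib Require Import Reals Lra.
From Coquelicot Require Import Coquelicot.
Open Scope R_scope.

Definition coth (x : R) : R := cosh x / sinh x.
Definition csch (x : R) : R := / sinh x.
Definition sech (x : R) : R := / cosh x.
Definition sec (x : R) : R := / cos x.
Definition csc (x : R) : R := / sin x.

Definition is_sign (s : R) : Prop := s = 1 \/ s = -1.

(* Charge inside radius r for the electric potential phi. *)
Definition charge (alpha omega phi : R -> R) (r : R) : R :=
  r ^ 2 * Derive phi r * exp (- (1 / 2) * (alpha r + omega r)).

(* Classical solutions on the open interval (a, b) of the static spherically
   symmetric Einstein-Maxwell perfect fluid equations for the metric
   exp(alpha) dr^2 + r^2 (dtheta^2 + sin^2 theta dvarphi^2) - exp(omega) dt^2.
   Since Derive is total, the existence of every derivative that occurs in the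
   equations is part of the definition. *)
Record einstein_maxwell_fluid (kappa a b : R)
    (alpha omega phi p rho : R -> R) : Prop := {
  emf_alpha_diff : forall r, a < r < b -> ex_derive alpha r;
  emf_omega_diff : forall r, a < r < b -> ex_derive omega r;
  emf_omega_diff2 : forall r, a < r < b -> ex_derive (Derive omega) r;
  emf_phi_diff : forall r, a < r < b -> ex_derive phi r;
  emf_pressure_radial : forall r, a < r < b ->
    kappa * p r - (charge alpha omega phi r) ^ 2 / r ^ 4 =
    - (1 / r ^ 2) + exp (- alpha r) / r ^ 2 * (1 + r * Derive omega r);
  emf_pressure_tangential : forall r, a < r < b ->
    kappa * p r + (charge alpha omega phi r) ^ 2 / r ^ 4 =
    exp (- alpha r) *
      (1 / 2 * Derive (Derive omega) r
       - 1 / 4 * Derive alpha r * Derive omega r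
       + 1 / 4 * (Derive omega r) ^ 2
       + (Derive omega r - Derive alpha r) / (2 * r));
  emf_density : forall r, a < r < b ->
    kappa * rho r + (charge alpha omega phi r) ^ 2 / r ^ 4 =
    1 / r ^ 2 - exp (- alpha r) / r ^ 2 * (1 - r * Derive alpha r)
}.

Definition Phi (F D Rad r : R) : R :=
  F - D * Rad ^ 2 * sqrt (1 - r ^ 2 / Rad ^ 2).

(* A exp(omega) = B + (C + phi)^2 on (a, b). *)
Definition functional_relation (a b A B C : R) (omega phi : R -> R) : Prop :=
  forall r, a < r < b -> A * exp (omega r) = B + (C + phi r) ^ 2.

(* The data (alpha, omega, phi, p, rho) solve the field equations on (a, b),
   with charge q and kappa rho + Q^2/r^4 = 3/Rad^2. *)
Definition solves_with_charge (kappa Rad a b : R)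
    (alpha omega phi p rho q : R -> R) : Prop :=
  einstein_maxwell_fluid kappa a b alpha omega phi p rho /\
  (forall r, a < r < b -> charge alpha omega phi r = q r) /\
  (forall r, a < r < b ->
    kappa * rho r + (charge alpha omega phi r) ^ 2 / r ^ 4 = 3 / Rad ^ 2).

(* [defined r] says that the denominators in the formulas do not vanish at r;
   eomega, q, kr, kp are the stated expressions for exp(omega), Q (up to sign),
   kappa rho, kappa p.

   The potential is only constrained by the functional relation, which at each
   point leaves the two roots -C + sqrt(A exp(omega) - B) and
   -C - sqrt(A exp(omega) - B).  The conclusion says that
   - both signs of Q occur;
   - every differentiable potential satisfying the relation gives a solution,
     with one sign of Q on the whole interval;
   - in particular so does each root.
   In the last item the root must be differentiable, whence the strict
   inequality.  It can fail only at a zero of Phi, when A = 1/2 and B > 0: there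
   the square root behaves like an absolute value, and the differentiable
   potentials pass from one root to the other. *)
Definition class_Ib_solution (kappa Rad a b A B C : R)
    (defined : R -> Prop) (eomega q kr kp : R -> R) : Prop :=
  (forall r, a < r < b -> defined r /\ 0 < eomega r) ->
  forall alpha omega p rho : R -> R,
  (forall r, a < r < b -> exp (- alpha r) = 1 - r ^ 2 / Rad ^ 2) ->
  (forall r, a < r < b -> exp (omega r) = eomega r) ->
  (forall r, a < r < b -> kappa * rho r = kr r) ->
  (forall r, a < r < b -> kappa * p r = kp r) ->
  (forall s, is_sign s -> exists phi : R -> R,
    functional_relation a b A B C omega phi /\
    solves_with_charge kappa Rad a b alpha omega phi p rho
      (fun r => s * q r)) /\
  (forall phi : R -> R,
    (forall r, a < r < b -> ex_derive phi r) ->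
    functional_relation a b A B C omega phi ->
    exists s, is_sign s /\
      solves_with_charge kappa Rad a b alpha omega phi p rho
        (fun r => s * q r)) /\
  (forall eps, is_sign eps ->
    (forall r, a < r < b -> B < A * exp (omega r)) ->
    let phi := fun r => - C + eps * sqrt (A * exp (omega r) - B) in
    functional_relation a b A B C omega phi /\
    exists s, is_sign s /\
      solves_with_charge kappa Rad a b alpha omega phi p rho
        (fun r => s * q r)).

(* Main.v *)
(* Write exp omega = Z(Phi)^2 and C + phi = +- G(Phi).  Since e^(-alpha) =
   1 - r^2/R^2 =: h^2 and Phi' = D r / h, the density and radial pressure
   equations only define rho and p, with Q = +- D r^3 G'/Z, and the tangential
   equation reduces to 2 G'^2 = Z Z'', primes denoting d/dPhi.  Each case is an
   explicit pair (Z, G) satisfying this and A Z^2 = B + G^2.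
   A single sign of Q on the whole interval: G' never vanishes, so
   (C + phi)/G(Phi) extends continuously by (C + phi)'/G(Phi)' across the zeros
   of G(Phi); its square is 1, hence it is constant. *)
Require Import Defs.
From Stdlib Require Import Reals Lra Ranalysis5.
From Coquelicot Require Import Coquelicot.
Open Scope R_scope.

(** * Signs, and functions that agree up to sign on an interval *)

Lemma is_sign_mult s t : is_sign s -> is_sign t -> is_sign (s * t).
Proof. intros [-> | ->] [-> | ->]; unfold is_sign; lra. Qed.

Lemma is_sign_sqr s : is_sign s -> s * s = 1.
Proof. intros [-> | ->]; lra. Qed.

Lemma locally_between (a b r : R) (P : R -> Prop) :
  a < r < b -> (forall x, a < x < b -> P x) -> locally r P.
Proof.
  intros [h1 h2] hP.
  exact (locally_interval P r (Finite a) (Finite b) h1 h2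
           (fun y hy1 hy2 => hP y (conj hy1 hy2))).
Qed.

(** If [k] took both values 1 and -1, the intermediate value theorem would give a zero in between,
    where the square is 0 and not 1. *)
Lemma continuous_sqr_eq_1_constant (a b : R) (k : R -> R) :
  a < b -> (forall r, a < r < b -> continuity_pt k r) ->
  (forall r, a < r < b -> k r * k r = 1) ->
  exists s, is_sign s /\ forall r, a < r < b -> k r = s.
Proof.
  intros hab hc h1.
  assert (hs : forall r, a < r < b -> k r = 1 \/ k r = -1).
  { intros r hr. specialize (h1 r hr).
    assert (h : (k r - 1) * (k r + 1) = 0) by lra.
    apply Rmult_integral in h. destruct h; [left | right]; lra. }
  assert (no : forall f x y, (forall r, a < r < b -> continuity_pt f r) ->
    (forall r, a < r < b -> f r * f r = 1) ->
    a < x -> x < y -> y < b -> f x < 0 -> 0 < f y -> False).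
  { intros f x y fc f1 ax xy yb fx fy.
    destruct (IVT_interv f x y) as [z [hz fz]]; auto.
    - intros r hr. apply fc. lra.
    - assert (a < z < b) as hz' by lra. specialize (f1 z hz').
      rewrite fz in f1. lra. }
  assert (cst : forall x y, a < x -> x < y -> y < b -> k x = k y).
  { intros x y ax xy yb.
    destruct (hs x) as [ex | ex]; [lra | |]; destruct (hs y) as [ey | ey];
      try lra; exfalso.
    (* A drop from 1 to -1 is a rise for [- k], so [no] covers both directions. *)
    - apply (no (fun r => - k r) x y); auto; try lra.
      + intros r hr. apply continuity_pt_opp. auto.
      + intros r hr. specialize (h1 r hr). lra.
    - apply (no k x y); auto; lra. }
  exists (k ((a + b) / 2)). split.
  - apply hs. lra.
  - intros r hr. destruct (Rtotal_order r ((a + b) / 2)) as [h | [-> | h]].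
    + apply cst; lra.
    + reflexivity.
    + symmetry. apply cst; lra.
Qed.

(** Since [f] and [g] vanish at [x], [f y / g y] is the quotient of their difference quotients,
    which tend to [l] and [m]. A zero of [g] at [y] would make its difference quotient 0, at
    distance |m| from [m]; this is excluded near [x]. *)
Lemma quotient_limit_at_common_zero (f g : R -> R) (x l m : R) :
  derivable_pt_lim f x l -> derivable_pt_lim g x m ->
  f x = 0 -> g x = 0 -> m <> 0 ->
  forall eps, 0 < eps -> exists d, 0 < d /\
    forall y, y <> x -> Rabs (y - x) < d ->
      g y <> 0 /\ Rabs (f y / g y - l / m) < eps.
Proof.
  intros hf hg fx gx hm.
  assert (lf : limit1_in (fun h => (f (x + h) - f x) / h) (fun h => h <> 0) l 0).
  { intros eps he. destruct (hf eps he) as [d hd]. exists d. split.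
    - apply cond_pos.
    - intros h [h0 hh]. simpl in *. unfold Rdist in *. rewrite Rminus_0_r in hh. auto. }
  assert (lg : limit1_in (fun h => (g (x + h) - g x) / h) (fun h => h <> 0) m 0).
  { intros eps he. destruct (hg eps he) as [d hd]. exists d. split.
    - apply cond_pos.
    - intros h [h0 hh]. simpl in *. unfold Rdist in *. rewrite Rminus_0_r in hh. auto. }
  assert (lq := limit_mul _ _ _ _ _ _ lf (limit_inv _ _ _ _ lg hm)).
  intros eps he.
  destruct (lq eps he) as [d1 [hd1 q1]].
  destruct (lg (Rabs m)) as [d2 [hd2 q2]]. { apply Rabs_pos_lt; auto. }
  simpl in *. unfold Rdist in *.
  exists (Rmin d1 d2). split. { apply Rmin_glb_lt; auto. }
  intros y yx hy.
  assert (hy1 := Rlt_le_trans _ _ _ hy (Rmin_l _ _)).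
  assert (hy2 := Rlt_le_trans _ _ _ hy (Rmin_r _ _)).
  specialize (q1 (y - x)). specialize (q2 (y - x)).
  rewrite Rminus_0_r in q1, q2.
  replace (x + (y - x)) with y in q1, q2 by ring.
  rewrite fx, gx in q1. rewrite gx in q2.
  assert (yx0 : y - x <> 0) by lra.
  specialize (q1 (conj yx0 hy1)). specialize (q2 (conj yx0 hy2)).
  assert (gy : g y <> 0).
  { intros gy. rewrite gy in q2.
    replace ((0 - 0) / (y - x) - m) with (- m) in q2 by (field; auto).
    rewrite Rabs_Ropp in q2. lra. }
  split; auto.
  replace (f y / g y - l / m)
    with ((f y - 0) / (y - x) * / ((g y - 0) / (y - x)) - l * / m); auto.
  field. auto.
Qed.

(* The quotient f / g, extended by f' / g' at the zeros of g, is continuous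
   with square 1. *)
Lemma sqr_eq_same_up_to_sign (a b : R) (f g f' g' : R -> R) :
  a < b ->
  (forall r, a < r < b -> is_derive f r (f' r)) ->
  (forall r, a < r < b -> is_derive g r (g' r)) ->
  (forall r, a < r < b -> g' r <> 0) ->
  (forall r, a < r < b -> f r ^ 2 = g r ^ 2) ->
  exists s, is_sign s /\ forall r, a < r < b -> f r = s * g r.
Proof.
  intros hab df dg g0 fg.
  set (k := fun r => if Req_EM_T (g r) 0 then f' r / g' r else f r / g r).
  assert (k1 : forall r, a < r < b -> g r <> 0 -> k r * k r = 1).
  { intros r hr gr. unfold k. destruct (Req_EM_T (g r) 0) as [e | _]; [easy |].
    specialize (fg r hr). field_simplify; auto. rewrite fg. field. auto. }
  assert (kc : forall r, a < r < b -> continuity_pt k r).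
  { intros r hr. destruct (Req_dec (g r) 0) as [gr | gr].
    - assert (fr : f r = 0).
      { specialize (fg r hr). rewrite gr in fg.
        assert (h : f r * f r = 0) by lra.
        apply Rmult_integral in h. lra. }
      intros eps he.
      destruct (quotient_limit_at_common_zero f g r (f' r) (g' r)) with (eps := eps)
        as [d [hd q]]; auto.
      + apply is_derive_Reals. auto.
      + apply is_derive_Reals. auto.
      + exists d. split; auto. intros y [[_ yr] hy]. simpl in *. unfold Rdist in *.
        destruct (q y) as [gy qy]; auto.
        unfold k. destruct (Req_EM_T (g y) 0); [easy |].
        destruct (Req_EM_T (g r) 0); [auto | easy].
    - apply continuity_pt_filterlim.
      apply (continuous_ext_loc _ (fun r => f r / g r)).
      + assert (gc := ex_derive_continuous (V := R_NormedModule) g r (ex_intro _ _ (dg r hr))).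
        assert (h : locally (g r) (fun z => z <> 0)).
        { apply (open_neq 0). auto. }
        specialize (gc _ h). unfold filtermap in gc.
        revert gc. apply filter_imp. intros y hy. unfold k.
        destruct (Req_EM_T (g y) 0); easy.
      + apply (ex_derive_continuous (fun r => f r / g r)).
        apply ex_derive_div; auto; eexists; auto. }
  assert (k2 : forall r, a < r < b -> k r * k r = 1).
  { intros r hr. destruct (Req_dec (g r) 0) as [gr | gr]; auto.
    (* At a zero of [g] the value of [k * k] is a limit. Near [r] the zero is isolated, so [k * k]
       is 1 at nearby points, and by continuity it cannot differ from 1 at [r]. *)
    destruct (Req_dec (k r * k r) 1) as [e | ne]; auto. exfalso.
    assert (kk := continuity_pt_mult _ _ _ (kc r hr) (kc r hr)).
    destruct (kk (Rabs (1 - k r * k r))) as [d1 [hd1 q1]].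
    { apply Rabs_pos_lt. lra. }
    (* Applied to the pair [g], [g] only to learn that [g] has no other zero near [r]; the value 1
       of [eps] is arbitrary. *)
    destruct (quotient_limit_at_common_zero g g r (g' r) (g' r)) with (eps := 1)
        as [d2 [hd2 q2]]; auto; try (apply is_derive_Reals; auto); try lra.
    set (e := Rmin (Rmin d1 d2) (b - r) / 2).
    assert (he : 0 < e).
    { unfold e. apply Rdiv_lt_0_compat; [| lra]. repeat apply Rmin_glb_lt; lra. }
    assert (m1 := Rmin_l (Rmin d1 d2) (b - r)).
    assert (m2 := Rmin_r (Rmin d1 d2) (b - r)).
    assert (m3 := Rmin_l d1 d2). assert (m4 := Rmin_r d1 d2).
    assert (ab : Rabs (r + e - r) = e).
    { replace (r + e - r) with e by ring. apply Rabs_pos_eq. lra. }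
    specialize (q1 (r + e)). specialize (q2 (r + e)).
    simpl in q1. unfold Rdist, D_x, no_cond, mult_fct in q1. rewrite ab in q1, q2.
    destruct q2 as [gy _]; [lra | unfold e in *; lra |].
    rewrite k1 in q1; auto; [| unfold e in *; lra].
    assert (h : Rabs (1 - k r * k r) < Rabs (1 - k r * k r)); [| lra].
    apply q1. repeat split; auto; unfold e in *; lra. }
  destruct (continuous_sqr_eq_1_constant a b k hab kc k2) as [s [hs ks]].
  exists s. split; auto. intros r hr. destruct (Req_dec (g r) 0) as [gr | gr].
  - specialize (fg r hr). rewrite gr in *.
    assert (h : f r * f r = 0) by lra. apply Rmult_integral in h. lra.
  - rewrite <- (ks r hr). unfold k. destruct (Req_EM_T (g r) 0); [easy |]. field. auto.
Qed.

(** * Derivatives of the metric exponents and of Phi *)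

(** The functions [alpha] and [omega] are prescribed only through their exponentials and only on the
    interval. Near [r] one has [u] = ln f, which yields differentiability together with the
    derivative. *)
Lemma is_derive_from_exp (a b : R) (u f : R -> R) (l r : R) :
  a < r < b -> (forall x, a < x < b -> exp (u x) = f x) ->
  is_derive f r l -> is_derive u r (l / f r).
Proof.
  intros hr hu df.
  apply (is_derive_ext_loc (fun x => ln (f x))).
  - apply (locally_between a b); auto. intros x hx. rewrite <- hu, ln_exp; auto.
  - assert (h : 0 < f r) by (rewrite <- hu; auto; apply exp_pos).
    exact (is_derive_comp ln f r (/ f r) l (is_derive_ln _ h) df).
Qed.

Lemma radicand_pos (Rad r : R) : 0 < r < Rad -> 0 < 1 - r ^ 2 / Rad ^ 2.
Proof.
  intros hr. assert (0 < Rad ^ 2) by (apply pow_lt; lra).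
  replace (1 - r ^ 2 / Rad ^ 2) with ((Rad - r) * (Rad + r) / Rad ^ 2)
    by (field; lra).
  apply Rdiv_lt_0_compat; auto. apply Rmult_lt_0_compat; lra.
Qed.

Lemma is_derive_radical (Rad r : R) : 0 < r < Rad ->
  is_derive (fun x => sqrt (1 - x ^ 2 / Rad ^ 2)) r
    (- (r / (Rad ^ 2 * sqrt (1 - r ^ 2 / Rad ^ 2)))).
Proof.
  intros hr. assert (h := radicand_pos Rad r hr).
  assert (hs := sqrt_lt_R0 _ h).
  evar_last.
  - apply (is_derive_sqrt (fun x => 1 - x ^ 2 / Rad ^ 2)); auto.
    auto_derive; [exact I | reflexivity].
  - field. lra.
Qed.

Lemma is_derive_Phi (F D Rad r : R) : 0 < r < Rad ->
  is_derive (Phi F D Rad) r (D * r / sqrt (1 - r ^ 2 / Rad ^ 2)).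
Proof.
  intros hr. assert (hs := sqrt_lt_R0 _ (radicand_pos Rad r hr)).
  unfold Phi. evar_last.
  - apply @is_derive_minus; [apply is_derive_const |].
    apply is_derive_scal. apply is_derive_radical, hr.
  - set (w := sqrt _) in *.
    change (0 - D * Rad ^ 2 * - (r / (Rad ^ 2 * w)) = D * r / w). field. lra.
Qed.

Lemma is_derive_Phi_slope (D Rad r : R) : 0 < r < Rad ->
  is_derive (fun x => D * x / sqrt (1 - x ^ 2 / Rad ^ 2)) r
    (D / sqrt (1 - r ^ 2 / Rad ^ 2) ^ 3).
Proof.
  intros hr. assert (h := radicand_pos Rad r hr).
  assert (hs := sqrt_lt_R0 _ h).
  assert (h2 := pow2_sqrt _ (Rlt_le _ _ h)).
  evar_last.
  - apply is_derive_div; [| apply is_derive_radical, hr | lra].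
    auto_derive; [exact I | reflexivity].
  - cbv beta. set (w := sqrt _) in *.
    (* Eliminating [r ^ 2] collapses the quotient rule, because w^2 + r^2/Rad^2 = 1. *)
    assert (e : r ^ 2 = Rad ^ 2 * (1 - w ^ 2)) by (rewrite h2; field; lra).
    field_simplify_eq; [| lra]. rewrite e. ring.
Qed.

(** * Reduction of the field equations to a profile in Phi *)

(* With [Z] and [G] read as functions of Phi, sqrt (exp omega) = |Z| and
   C + phi = +- G; the last field is what remains of the field equations. *)
Record profile (A B : R) (Z Z1 Z2 G G1 : R -> R) (x : R) : Prop := {
  profile_dZ : is_derive Z x (Z1 x);
  profile_dZ1 : is_derive Z1 x (Z2 x);
  profile_dG : is_derive G x (G1 x);
  profile_Z_neq_0 : Z x <> 0;
  profile_G1_neq_0 : G1 x <> 0;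
  profile_relation : A * Z x ^ 2 = B + G x ^ 2;
  profile_ode : 2 * G1 x ^ 2 = Z x * Z2 x
}.

(** The field equations see [phi] only through its derivative, so [phi] enters as phi' = s
    (G(Phi))', without [C]. The constant [t] is Z/|Z|: it appears because [charge] contains
    exp(-omega/2) = 1/|Z|, whereas the formulas divide by Z. *)
Lemma profile_solves (kappa Rad F D a b A B s t : R) (Z Z1 Z2 G G1 : R -> R)
    (alpha omega p rho phi : R -> R) :
  0 <= a -> b <= Rad ->
  (forall r, a < r < b -> profile A B Z Z1 Z2 G G1 (Phi F D Rad r)) ->
  (forall r, a < r < b -> exp (- alpha r) = 1 - r ^ 2 / Rad ^ 2) ->
  (forall r, a < r < b -> exp (omega r) = Z (Phi F D Rad r) ^ 2) ->
  (forall r, a < r < b -> kappa * rho r = 3 / Rad ^ 2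
     - D ^ 2 * r ^ 2 * (G1 (Phi F D Rad r) / Z (Phi F D Rad r)) ^ 2) ->
  (forall r, a < r < b -> kappa * p r = - (1 / Rad ^ 2)
     + D ^ 2 * r ^ 2 * (G1 (Phi F D Rad r) / Z (Phi F D Rad r)) ^ 2
     + 2 * D * sqrt (1 - r ^ 2 / Rad ^ 2)
         * (Z1 (Phi F D Rad r) / Z (Phi F D Rad r))) ->
  is_sign s -> is_sign t ->
  (forall r, a < r < b -> is_derive phi r
     (s * (G1 (Phi F D Rad r) * (D * r / sqrt (1 - r ^ 2 / Rad ^ 2))))) ->
  (forall r, a < r < b ->
     exp (- (1 / 2) * omega r) * Z (Phi F D Rad r) = t) ->
  solves_with_charge kappa Rad a b alpha omega phi p rho
    (fun r => s * t * (D * r ^ 3 * G1 (Phi F D Rad r) / Z (Phi F D Rad r))).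
Proof.
  intros ha hb hprof halpha homega hrho hp hs ht hphi hZt.
  set (P := Phi F D Rad) in *.
  set (h := fun r => sqrt (1 - r ^ 2 / Rad ^ 2)).
  assert (hr0 : forall r, a < r < b -> 0 < r < Rad) by (intros; lra).
  assert (h2 : forall r, a < r < b -> h r ^ 2 = 1 - r ^ 2 / Rad ^ 2).
  { intros r hr. apply pow2_sqrt, Rlt_le, radicand_pos. auto. }
  assert (hpos : forall r, a < r < b -> 0 < h r).
  { intros r hr. apply sqrt_lt_R0, radicand_pos. auto. }
  (* Used to eliminate [Rad], so that the equations become rational identities in the independent
     quantities [r] and [h r]. *)
  assert (hRad : forall r, a < r < b -> / Rad ^ 2 = (1 - h r ^ 2) / r ^ 2).
  { intros r hr. rewrite h2; auto. specialize (hr0 r hr). field. lra. }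
  assert (dP : forall r, a < r < b -> is_derive P r (D * r / h r)).
  { intros r hr. apply is_derive_Phi. auto. }
  assert (dalpha : forall r, a < r < b ->
    is_derive alpha r (2 * (1 - h r ^ 2) / (r * h r ^ 2))).
  { intros r hr. specialize (hr0 r hr). specialize (hpos r hr).
    apply (is_derive_ext (fun x => - - alpha x)). { intros x. apply Ropp_involutive. }
    evar_last.
    - apply @is_derive_opp.
      apply (is_derive_from_exp a b (fun x => - alpha x) (fun x => 1 - x ^ 2 / Rad ^ 2));
        auto.
      auto_derive; [exact I | reflexivity].
    - rewrite <- h2; auto. change opp with Ropp.
      replace (1 - h r ^ 2) with (r ^ 2 * / Rad ^ 2)
        by (rewrite (hRad r hr); field; lra).
      field. lra. }
  (* This is the derivative of omega = 2 ln |Z(Phi)|, whatever the sign of Z. *)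
  assert (domega : forall r, a < r < b ->
    is_derive omega r (2 * (Z1 (P r) / Z (P r)) * (D * r / h r))).
  { intros r hr. destruct (hprof r hr). specialize (hpos r hr).
    evar_last.
    - apply (is_derive_from_exp a b omega (fun x => Z (P x) ^ 2)); auto.
      apply is_derive_pow. apply is_derive_comp; eauto.
    - unfold scal; simpl; unfold mult; simpl. field. lra. }
  assert (domega2 : forall r, a < r < b -> is_derive (Derive omega) r
    (2 * ((Z2 (P r) / Z (P r) - (Z1 (P r) / Z (P r)) ^ 2) * (D * r / h r) ^ 2
          + Z1 (P r) / Z (P r) * (D / h r ^ 3)))).
  { intros r hr. destruct (hprof r hr).
    apply (is_derive_ext_loc
             (fun x => 2 * (Z1 (P x) / Z (P x)) * (D * x / h x))).
    { apply (locally_between a b); auto. intros x hx. symmetry.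
      apply is_derive_unique. auto. }
    evar_last.
    - apply (is_derive_mult (fun x => 2 * (Z1 (P x) / Z (P x)))
               (fun x => D * x / h x) r
               (2 * ((Z2 (P r) / Z (P r) - (Z1 (P r) / Z (P r)) ^ 2) * (D * r / h r)))
               (D / h r ^ 3)); [| apply is_derive_Phi_slope; auto | exact Rmult_comm].
      apply is_derive_scal. evar_last.
      + apply (is_derive_comp (fun y => Z1 y / Z y) P r
                 ((Z2 (P r) * Z (P r) - Z1 (P r) * Z1 (P r)) / Z (P r) ^ 2)
                 (D * r / h r)); [| apply dP; auto].
        apply (is_derive_div Z1 Z); auto.
      + specialize (hpos r hr). change scal with Rmult. field. lra.
    - change plus with Rplus. change mult with Rmult. cbv beta. ring. }
  assert (hcharge : forall r, a < r < b -> charge alpha omega phi r =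
    s * t * (D * r ^ 3 * G1 (P r) / Z (P r))).
  { intros r hr. specialize (hr0 r hr). destruct (hprof r hr).
    unfold charge. rewrite (is_derive_unique _ _ _ (hphi r hr)).
    rewrite Rmult_plus_distr_l, exp_plus.
    replace (exp (- (1 / 2) * alpha r)) with (h r).
    2:{ unfold h. rewrite <- halpha; auto.
        replace (- alpha r) with (- (1 / 2) * alpha r + - (1 / 2) * alpha r) by lra.
        rewrite exp_plus. apply sqrt_square, Rlt_le, exp_pos. }
    rewrite <- (hZt r hr). specialize (hpos r hr). fold (h r). field. lra. }
  assert (hq2 : forall r, a < r < b -> charge alpha omega phi r ^ 2 / r ^ 4 =
    D ^ 2 * r ^ 2 * (G1 (P r) / Z (P r)) ^ 2).
  { intros r hr. rewrite hcharge; auto.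
    assert (es := is_sign_sqr s hs). assert (et := is_sign_sqr t ht).
    replace ((s * t * (D * r ^ 3 * G1 (P r) / Z (P r))) ^ 2)
      with ((s * s) * (t * t) * (D * r ^ 3 * G1 (P r) / Z (P r)) ^ 2) by ring.
    rewrite es, et. specialize (hr0 r hr). destruct (hprof r hr). field. lra. }
  split; [split | split]; auto.
  - intros r hr. eexists. apply dalpha, hr.
  - intros r hr. eexists. apply domega, hr.
  - intros r hr. eexists. apply domega2, hr.
  - intros r hr. eexists. apply hphi, hr.
  - intros r hr. rewrite hq2, hp, halpha, (is_derive_unique _ _ _ (domega r hr)); auto.
    fold (h r). rewrite <- (h2 r hr). unfold Rdiv. rewrite (hRad r hr).
    specialize (hr0 r hr). destruct (hprof r hr). specialize (hpos r hr). fold (P r).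
    field. lra.
  - intros r hr. rewrite hq2, hp, halpha, (is_derive_unique _ _ _ (domega r hr)),
      (is_derive_unique _ _ _ (domega2 r hr)), (is_derive_unique _ _ _ (dalpha r hr)); auto.
    fold (h r). rewrite <- (h2 r hr). unfold Rdiv. rewrite (hRad r hr).
    specialize (hr0 r hr). destruct (hprof r hr). specialize (hpos r hr). fold (P r).
    (* The relation 2 G'^2 = Z Z'' enters here: it removes G' from the tangential equation, and what
       remains is an identity in Z, Z', Z'', [h r] and [r]. *)
    replace ((G1 (P r) * / Z (P r)) ^ 2) with (Z2 (P r) / (2 * Z (P r))).
    + field. lra.
    + field_simplify_eq; auto. lra.
  - intros r hr. rewrite hq2, hrho, halpha, (is_derive_unique _ _ _ (dalpha r hr)); auto.
    rewrite <- (h2 r hr). unfold Rdiv. rewrite (hRad r hr).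
    specialize (hr0 r hr). destruct (hprof r hr). specialize (hpos r hr). fold (P r).
    field. lra.
  - intros r hr. rewrite hq2, hrho; auto. fold (P r). lra.
Qed.

(** Reduces each family to checking a profile and four closed formulas at a point. The sign [q0]
    absorbs the difference between the stated Q and D r^3 G'/Z, which is negative relative to it
    when G'/Z carries a minus sign. *)
Lemma class_Ib_of_profile (kappa Rad F D a b A B C q0 : R) (Z Z1 Z2 G G1 : R -> R)
    (defined : R -> Prop) (eomega q kr kp : R -> R) :
  0 <= a -> a < b -> b <= Rad -> 0 < D -> is_sign q0 ->
  (forall r, a < r < b -> defined r -> 0 < eomega r ->
     profile A B Z Z1 Z2 G G1 (Phi F D Rad r) /\
     eomega r = Z (Phi F D Rad r) ^ 2 /\
     q r = q0 * (D * r ^ 3 * G1 (Phi F D Rad r) / Z (Phi F D Rad r)) /\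
     kr r = 3 / Rad ^ 2
       - D ^ 2 * r ^ 2 * (G1 (Phi F D Rad r) / Z (Phi F D Rad r)) ^ 2 /\
     kp r = - (1 / Rad ^ 2)
       + D ^ 2 * r ^ 2 * (G1 (Phi F D Rad r) / Z (Phi F D Rad r)) ^ 2
       + 2 * D * sqrt (1 - r ^ 2 / Rad ^ 2)
           * (Z1 (Phi F D Rad r) / Z (Phi F D Rad r))) ->
  class_Ib_solution kappa Rad a b A B C defined eomega q kr kp.
Proof.
  intros ha hab hb hD hq0 H hdef alpha omega p rho halpha homega hrho hp.
  set (P := Phi F D Rad) in *.
  set (h := fun r => sqrt (1 - r ^ 2 / Rad ^ 2)).
  assert (H' := fun r hr => H r hr (proj1 (hdef r hr)) (proj2 (hdef r hr))).
  clear H.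
  assert (hpos : forall r, a < r < b -> 0 < h r).
  { intros r hr. apply sqrt_lt_R0, radicand_pos. lra. }
  assert (dP : forall r, a < r < b -> is_derive P r (D * r / h r)).
  { intros r hr. apply is_derive_Phi. lra. }
  assert (dZ : forall r, a < r < b ->
    is_derive (fun x => Z (P x)) r (D * r / h r * Z1 (P r))).
  { intros r hr. apply (is_derive_comp Z P); auto. apply (H' r hr). }
  assert (dG : forall r, a < r < b ->
    is_derive (fun x => G (P x)) r (G1 (P r) * (D * r / h r))).
  { intros r hr. rewrite Rmult_comm. apply (is_derive_comp G P); auto. apply (H' r hr). }
  assert (domega : forall r, a < r < b -> ex_derive omega r).
  { intros r hr. eexists.
    apply (is_derive_from_exp a b omega (fun x => Z (P x) ^ 2)); auto.
    - intros x hx. rewrite homega; auto. apply (H' x hx).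
    - apply is_derive_pow. apply dZ, hr. }
  (* The function Z(Phi)/|Z(Phi)| is continuous with square 1, hence constant on the interval. *)
  assert (ht : exists t, is_sign t /\
    forall r, a < r < b -> exp (- (1 / 2) * omega r) * Z (P r) = t).
  { apply continuous_sqr_eq_1_constant; auto.
    - intros r hr. apply continuity_pt_filterlim.
      apply (ex_derive_continuous (fun r => exp (- (1 / 2) * omega r) * Z (P r))).
      apply ex_derive_mult.
      + apply (ex_derive_comp exp (fun r => - (1 / 2) * omega r)).
        * eexists. apply is_derive_exp.
        * apply (ex_derive_scal omega (- (1 / 2))). auto.
      + eexists. apply dZ, hr.
    - intros r hr.
      replace (exp (- (1 / 2) * omega r) * Z (P r) *
               (exp (- (1 / 2) * omega r) * Z (P r)))
        with (exp (- (1 / 2) * omega r) * exp (- (1 / 2) * omega r) * Z (P r) ^ 2)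
        by ring.
      destruct (H' r hr) as [_ [e _]].
      rewrite <- e, <- homega, <- !exp_plus; auto.
      transitivity (exp 0); [f_equal; lra | apply exp_0]. }
  destruct ht as [t [ht hZt]].
  (* In terms of the sign s of C + phi = s G, the sign of Q is s t q0. *)
  assert (key : forall (phi : R -> R) s, is_sign s ->
    (forall r, a < r < b -> C + phi r = s * G (P r)) ->
    solves_with_charge kappa Rad a b alpha omega phi p rho
      (fun r => s * t * q0 * q r)).
  { intros phi s hs hphi.
    destruct (profile_solves kappa Rad F D a b A B s t Z Z1 Z2 G G1
                alpha omega p rho phi) as [h1 [h2 h3]]; auto.
    - intros r hr. apply (H' r hr).
    - intros r hr. rewrite homega; auto. apply (H' r hr).
    - intros r hr. rewrite hrho; auto. apply (H' r hr).
    - intros r hr. rewrite hp; auto. apply (H' r hr).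
    (* Differentiability of [phi] is not assumed in [key]; it comes from G, as [phi] coincides with
       s G(Phi) - C near [r]. *)
    - intros r hr. apply (is_derive_ext_loc (fun x => s * G (P x) - C)).
      + apply (locally_between a b); auto. intros x hx.
        change (s * G (P x) - C = phi x). rewrite <- hphi; auto. ring.
      + evar_last.
        * apply @is_derive_minus; [| apply is_derive_const].
          apply is_derive_scal, dG, hr.
        * apply @minus_zero_r.
    - split; [| split]; auto. intros r hr. rewrite h2; auto.
      destruct (H' r hr) as [_ [_ [e _]]]. rewrite e. fold (P r).
      rewrite <- (Rmult_1_l (D * r ^ 3 * G1 (P r) / Z (P r))) at 1.
      rewrite <- (is_sign_sqr q0 hq0). ring. }
  assert (rel : forall phi : R -> R, functional_relation a b A B C omega phi ->
    forall r, a < r < b -> (C + phi r) ^ 2 = G (P r) ^ 2).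
  { intros phi hphi r hr. specialize (hphi r hr). rewrite homega in hphi; auto.
    destruct (H' r hr) as [[_ _ _ _ _ e _] [e' _]]. rewrite e' in hphi.
    fold (P r) in *. lra. }
  assert (main : forall phi : R -> R, (forall r, a < r < b -> ex_derive phi r) ->
    functional_relation a b A B C omega phi ->
    exists s, is_sign s /\
      solves_with_charge kappa Rad a b alpha omega phi p rho (fun r => s * q r)).
  { intros phi dphi hphi.
    destruct (sqr_eq_same_up_to_sign a b (fun r => C + phi r) (fun r => G (P r))
                (Derive phi) (fun r => G1 (P r) * (D * r / h r))) as [s [hs e]]; auto.
    - intros r hr. evar_last.
      + apply @is_derive_plus; [apply is_derive_const | apply Derive_correct; auto].
      + apply @plus_zero_l.
    (* The derivative of G(Phi) has no zero: G' has none, and Phi' = D r / h is positive since D > 0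
       and r > a >= 0. *)
    - intros r hr. destruct (H' r hr) as [[_ _ _ _ g _ _] _].
      specialize (hpos r hr). apply Rmult_integral_contrapositive_currified; auto.
      apply Rgt_not_eq, Rdiv_lt_0_compat; auto. apply Rmult_lt_0_compat; lra.
    - exists (s * t * q0). split; auto. repeat apply is_sign_mult; auto. }
  split; [| split].
  - intros s hs.
    (* The potential with sign [s'] has charge sign s' t q0, which equals the wanted [s] because [t]
       and [q0] have square 1. *)
    set (s' := s * t * q0).
    assert (hs' : is_sign s') by (repeat apply is_sign_mult; auto).
    exists (fun r => - C + s' * G (P r)). split.
    + intros r hr. destruct (H' r hr) as [[_ _ _ _ _ e _] [e' _]].
      rewrite homega, e', e; auto. fold (P r).
      replace ((C + (- C + s' * G (P r))) ^ 2) with (s' * s' * G (P r) ^ 2) by ring.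
      rewrite is_sign_sqr; auto. ring.
    + replace s with (s' * t * q0).
      * apply key; auto. intros r hr. ring.
      * unfold s'.
        replace (s * t * q0 * t * q0) with (s * (t * t) * (q0 * q0)) by ring.
        rewrite !is_sign_sqr; auto. ring.
  - exact main.
  - intros eps he hlt phi.
    assert (hphi : functional_relation a b A B C omega phi).
    { intros r hr. unfold phi.
      replace ((C + (- C + eps * sqrt (A * exp (omega r) - B))) ^ 2)
        with (eps * eps * sqrt (A * exp (omega r) - B) ^ 2) by ring.
      rewrite is_sign_sqr, pow2_sqrt; auto; specialize (hlt r hr); lra. }
    split; auto. apply main; auto. intros r hr. unfold phi.
    specialize (hlt r hr).
    (* The strict inequality [hlt] keeps the radicand away from 0, where the square root is not
       differentiable. *)
    apply @ex_derive_plus; [apply ex_derive_const |].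
    apply @ex_derive_scal. specialize (domega r hr). auto_derive. split; auto. lra.
Qed.

(** * Hyperbolic and trigonometric identities and derivatives *)

Lemma Rmult3_neq_0 (x y z : R) : x <> 0 -> y <> 0 -> z <> 0 -> x * y * z <> 0.
Proof.
  intros. now repeat apply Rmult_integral_contrapositive_currified.
Qed.

Lemma cosh_sqr_minus_sinh_sqr (x : R) : cosh x ^ 2 - sinh x ^ 2 = 1.
Proof.
  unfold cosh, sinh.
  replace 1 with (exp x * exp (- x)).
  - field.
  - rewrite <- exp_plus, Rplus_opp_r. apply exp_0.
Qed.

Lemma cosh_pos (x : R) : 0 < cosh x.
Proof. unfold cosh. assert (h := exp_pos x). assert (h' := exp_pos (- x)). lra. Qed.

Lemma is_derive_sinh (x : R) : is_derive sinh x (cosh x).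
Proof. apply is_derive_Reals, derivable_pt_lim_sinh. Qed.

Lemma is_derive_cosh (x : R) : is_derive cosh x (sinh x).
Proof. apply is_derive_Reals, derivable_pt_lim_cosh. Qed.

(** The hyperbolic and trigonometric profiles consist of functions c f(k y). The derivative has the
    same shape, so the rule can be iterated; this is why the coefficients of Z' and Z'' are left as
    unsimplified products. *)
Lemma is_derive_dilate (f f' : R -> R) (c k x : R) :
  is_derive f (k * x) (f' (k * x)) ->
  is_derive (fun y => c * f (k * y)) x (c * k * f' (k * x)).
Proof.
  intros df. evar_last.
  - apply is_derive_scal. apply (is_derive_comp f (fun y => k * y)); [exact df |].
    auto_derive; [exact I | reflexivity].
  - change scal with Rmult. ring.
Qed.

Lemma is_derive_coth (x : R) : sinh x <> 0 -> is_derive coth x (- csch x ^ 2).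
Proof.
  intros hx. evar_last.
  - apply is_derive_div; [apply is_derive_cosh | apply is_derive_sinh | exact hx].
  - unfold csch. assert (h := cosh_sqr_minus_sinh_sqr x). field_simplify_eq; auto. lra.
Qed.

Lemma is_derive_csch (x : R) : sinh x <> 0 -> is_derive csch x (- (csch x * coth x)).
Proof.
  intros hx. evar_last.
  - apply is_derive_inv; [apply is_derive_sinh | exact hx].
  - unfold csch, coth. field. auto.
Qed.

Lemma is_derive_sec (x : R) : cos x <> 0 -> is_derive sec x (sec x * tan x).
Proof.
  intros hx. evar_last.
  - apply is_derive_inv; [apply is_derive_cos | exact hx].
  - unfold sec, tan. field. auto.
Qed.

Lemma is_derive_tan_sec (x : R) : cos x <> 0 -> is_derive tan x (sec x ^ 2).
Proof.
  intros hx. evar_last.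
  - apply is_derive_tan, hx.
  - unfold sec, tan. assert (h := sin2_cos2 x). unfold Rsqr in h.
    field_simplify_eq; auto. lra.
Qed.

(** * The explicit profiles *)

(** Here Z'' = k^2 Z and G' = k Z / v, so 2 G'^2 = Z Z'' amounts to v^2 = 2; the algebraic relation
    is cosh^2 - sinh^2 = 1. The intended values are w = sqrt B, v = sqrt 2, k = 1 / sqrt 2. *)
Lemma profile_cosh (w v k x : R) : 0 < w -> 0 < v -> v ^ 2 = 2 -> k * v = 1 ->
  profile (1 / 2) (w ^ 2) (fun y => w * v * cosh (k * y))
    (fun y => w * v * k * sinh (k * y)) (fun y => w * v * k * k * cosh (k * y))
    (fun y => w * sinh (k * y)) (fun y => w * k * cosh (k * y)) x.
Proof.
  intros hw hv v2 hk. assert (hc := cosh_pos (k * x)).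
  assert (h := cosh_sqr_minus_sinh_sqr (k * x)).
  assert (k0 : k <> 0) by (intros ->; lra).
  split.
  - apply is_derive_dilate, is_derive_cosh.
  - apply is_derive_dilate, is_derive_sinh.
  - apply is_derive_dilate, is_derive_sinh.
  - apply Rmult3_neq_0; auto; lra.
  - apply Rmult3_neq_0; auto; lra.
  - replace ((w * v * cosh (k * x)) ^ 2) with (w ^ 2 * v ^ 2 * cosh (k * x) ^ 2) by ring.
    rewrite v2. replace (cosh (k * x) ^ 2) with (1 + sinh (k * x) ^ 2) by lra. field.
  - rewrite <- v2. ring.
Qed.

(** The previous profile with sinh and cosh exchanged, which changes the sign of B. Now Z and G' are
    both multiples of sinh, so its zeros have to be excluded. *)
Lemma profile_sinh (w v k x : R) : 0 < w -> 0 < v -> v ^ 2 = 2 -> k * v = 1 ->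
  sinh (k * x) <> 0 ->
  profile (1 / 2) (- w ^ 2) (fun y => w * v * sinh (k * y))
    (fun y => w * v * k * cosh (k * y)) (fun y => w * v * k * k * sinh (k * y))
    (fun y => w * cosh (k * y)) (fun y => w * k * sinh (k * y)) x.
Proof.
  intros hw hv v2 hk hs.
  assert (h := cosh_sqr_minus_sinh_sqr (k * x)).
  assert (k0 : k <> 0) by (intros ->; lra).
  split.
  - apply is_derive_dilate, is_derive_sinh.
  - apply is_derive_dilate, is_derive_cosh.
  - apply is_derive_dilate, is_derive_cosh.
  - apply Rmult3_neq_0; auto; lra.
  - apply Rmult3_neq_0; auto; lra.
  - replace ((w * v * sinh (k * x)) ^ 2) with (w ^ 2 * v ^ 2 * sinh (k * x) ^ 2) by ring.
    rewrite v2. replace (sinh (k * x) ^ 2) with (cosh (k * x) ^ 2 - 1) by lra. field.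
  - rewrite <- v2. ring.
Qed.

(** The algebraic relation is coth^2 = 1 + csch^2, and both sides of the differential relation equal
    2 w^4 csch^2 coth^2. *)
Lemma profile_coth (w x : R) : 0 < w -> sinh (w * x) <> 0 ->
  profile 1 (w ^ 2) (fun y => w * coth (w * y))
    (fun y => w * w * - csch (w * y) ^ 2)
    (fun y => w * w * w * (2 * csch (w * y) ^ 2 * coth (w * y)))
    (fun y => w * csch (w * y))
    (fun y => w * w * - (csch (w * y) * coth (w * y))) x.
Proof.
  intros hw hs.
  assert (hc : 0 < cosh (w * x)) by apply cosh_pos.
  assert (h := cosh_sqr_minus_sinh_sqr (w * x)).
  assert (csch (w * x) <> 0) by (apply Rinv_neq_0_compat; auto).
  assert (coth (w * x) <> 0).
  { apply Rmult_integral_contrapositive_currified; [lra | auto]. }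
  split.
  - apply (is_derive_dilate coth (fun z => - csch z ^ 2)), is_derive_coth, hs.
  - apply (is_derive_dilate (fun z => - csch z ^ 2) (fun z => 2 * csch z ^ 2 * coth z)).
    evar_last.
    + apply @is_derive_opp, is_derive_pow, is_derive_csch, hs.
    + change opp with Ropp. simpl. ring.
  - apply (is_derive_dilate csch (fun z => - (csch z * coth z))), is_derive_csch, hs.
  - apply Rmult_integral_contrapositive_currified; auto; lra.
  - apply Rmult3_neq_0; auto; try lra.
    apply Ropp_neq_0_compat, Rmult_integral_contrapositive_currified; auto.
  - unfold coth, csch. field_simplify_eq; auto.
    replace (cosh (w * x) ^ 2) with (1 + sinh (w * x) ^ 2) by lra. ring.
  - ring.
Qed.

(** The trigonometric counterpart, resting on sec^2 = 1 + tan^2. The zeros of sin are excluded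
    because Z and G' vanish there. *)
Lemma profile_tan (w x : R) : 0 < w -> cos (w * x) <> 0 -> sin (w * x) <> 0 ->
  profile 1 (- w ^ 2) (fun y => w * tan (w * y))
    (fun y => w * w * sec (w * y) ^ 2)
    (fun y => w * w * w * (2 * sec (w * y) ^ 2 * tan (w * y)))
    (fun y => w * sec (w * y))
    (fun y => w * w * (sec (w * y) * tan (w * y))) x.
Proof.
  intros hw hc hs.
  assert (h := sin2_cos2 (w * x)). unfold Rsqr in h.
  assert (sec (w * x) <> 0) by (apply Rinv_neq_0_compat; auto).
  assert (tan (w * x) <> 0).
  { apply Rmult_integral_contrapositive_currified; auto. }
  split.
  - apply (is_derive_dilate tan (fun z => sec z ^ 2)), is_derive_tan_sec, hc.
  - apply (is_derive_dilate (fun z => sec z ^ 2) (fun z => 2 * sec z ^ 2 * tan z)).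
    evar_last.
    + apply is_derive_pow, is_derive_sec, hc.
    + simpl. ring.
  - apply (is_derive_dilate sec (fun z => sec z * tan z)), is_derive_sec, hc.
  - apply Rmult_integral_contrapositive_currified; auto; lra.
  - apply Rmult3_neq_0; auto; lra.
  - unfold tan, sec. field_simplify_eq; auto.
    replace (sin (w * x) ^ 2) with (1 - cos (w * x) ^ 2) by lra. ring.
  - ring.
Qed.

(** The stated exp omega is Z^2 = 2 B^3 y^2 / E, so G^2 = (3/2) Z^2 - B = 2 B / E and Z may be taken
    as B y G. Since G'/G is rational, each derivative is G times a rational function, and the
    differential relation is rational after cancelling G^2. *)
Lemma profile_rational (B x : R) : 0 < B / (3 * B ^ 2 * x ^ 2 - 2) -> x <> 0 ->
  let E := fun y => 3 * B ^ 2 * y ^ 2 - 2 in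
  let G := fun y => sqrt (2 * (B / E y)) in
  profile (3 / 2) B (fun y => B * y * G y) (fun y => - 2 * B * G y / E y)
    (fun y => 18 * B ^ 3 * y * G y / E y ^ 2) G
    (fun y => - 3 * B ^ 2 * y * G y / E y) x.
Proof.
  intros hBE hx E G. change (0 < B / E x) in hBE.
  assert (hE : E x <> 0).
  (* With the convention / 0 = 0, a vanishing denominator would make the quotient 0, against its
     positivity. *)
  { intros e. rewrite e in hBE. unfold Rdiv in hBE. rewrite Rinv_0 in hBE. lra. }
  assert (hB : B <> 0).
  { intros e. rewrite e in hBE. unfold Rdiv in hBE. lra. }
  assert (hG : 0 < G x) by (apply sqrt_lt_R0; lra).
  assert (hG2 : G x ^ 2 = 2 * (B / E x)) by (apply pow2_sqrt; lra).
  assert (dE : is_derive E x (6 * B ^ 2 * x)).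
  { unfold E. auto_derive; [exact I | ring]. }
  assert (dG : is_derive G x (- 3 * B ^ 2 * x * G x / E x)).
  { evar_last.
    - apply (is_derive_sqrt (fun y => 2 * (B / E y))); [| lra].
      apply is_derive_scal. apply is_derive_div; [apply is_derive_const | exact dE | exact hE].
    - change zero with 0. fold (G x). field_simplify_eq; auto; [| lra].
      rewrite hG2. field. auto. }
  split; auto.
  - evar_last.
    + apply (is_derive_mult (fun y => B * y) G x B); [| exact dG | exact Rmult_comm].
      auto_derive; [exact I | ring].
    + change plus with Rplus. change mult with Rmult. unfold E in *. field. auto.
  - evar_last.
    + apply is_derive_div; [apply is_derive_scal, dG | exact dE | exact hE].
    + cbv beta. field. auto.
  - apply Rmult3_neq_0; auto. lra.
  - apply Rmult_integral_contrapositive_currified; [| apply Rinv_neq_0_compat; auto].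
    apply Rmult3_neq_0; auto; [| lra].
    apply Rmult_integral_contrapositive_currified; [lra | apply pow_nonzero; auto].
  - replace ((B * x * G x) ^ 2) with (B ^ 2 * x ^ 2 * G x ^ 2) by ring.
    rewrite hG2. unfold E in *. field. auto.
  - field. auto.
Qed.

(** * Verification of the families of solutions *)

Theorem mainTheorem8
  (kappa B D Rad F C a b : R)
  (hkappa : 0 < kappa) (hB : B <> 0) (hD : 0 < D) (hRad : 0 < Rad)
  (ha : 0 <= a) (hab : a < b) (hb : b <= Rad) :
  (0 < B ->
   class_Ib_solution kappa Rad a b (1 / 2) B C
     (fun r => True)
     (fun r => 2 * B * (cosh (Phi F D Rad r / sqrt 2)) ^ 2)
     (fun r => D * r ^ 3 / 2)
     (fun r => 3 / Rad ^ 2 - D ^ 2 * r ^ 2 / 4)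
     (fun r => - (1 / Rad ^ 2) + D ^ 2 * r ^ 2 / 4
        + sqrt 2 * D * sqrt (1 - r ^ 2 / Rad ^ 2)
          * tanh (Phi F D Rad r / sqrt 2))) /\
  (B < 0 ->
   class_Ib_solution kappa Rad a b (1 / 2) B C
     (fun r => sinh (Phi F D Rad r / sqrt 2) <> 0)
     (fun r => - 2 * B * (sinh (Phi F D Rad r / sqrt 2)) ^ 2)
     (fun r => D * r ^ 3 / 2)
     (fun r => 3 / Rad ^ 2 - D ^ 2 * r ^ 2 / 4)
     (fun r => - (1 / Rad ^ 2) + D ^ 2 * r ^ 2 / 4
        + sqrt 2 * D * sqrt (1 - r ^ 2 / Rad ^ 2)
          * coth (Phi F D Rad r / sqrt 2))) /\
  (0 < B ->
   class_Ib_solution kappa Rad a b 1 B C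
     (fun r => sinh (sqrt B * Phi F D Rad r) <> 0)
     (fun r => B * (coth (sqrt B * Phi F D Rad r)) ^ 2)
     (fun r => sqrt B * D * r ^ 3 * csch (sqrt B * Phi F D Rad r))
     (fun r => 3 / Rad ^ 2
        - B * D ^ 2 * r ^ 2 * (csch (sqrt B * Phi F D Rad r)) ^ 2)
     (fun r => - (1 / Rad ^ 2)
        + B * D ^ 2 * r ^ 2 * (csch (sqrt B * Phi F D Rad r)) ^ 2
        - 2 * sqrt B * D * sech (sqrt B * Phi F D Rad r)
          * csch (sqrt B * Phi F D Rad r) * sqrt (1 - r ^ 2 / Rad ^ 2))) /\
  (B < 0 ->
   class_Ib_solution kappa Rad a b 1 B C
     (fun r => cos (sqrt (- B) * Phi F D Rad r) <> 0 /\
               sin (sqrt (- B) * Phi F D Rad r) <> 0)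
     (fun r => - B * (tan (sqrt (- B) * Phi F D Rad r)) ^ 2)
     (fun r => sqrt (- B) * D * r ^ 3 * sec (sqrt (- B) * Phi F D Rad r))
     (fun r => 3 / Rad ^ 2
        + B * D ^ 2 * r ^ 2 * (sec (sqrt (- B) * Phi F D Rad r)) ^ 2)
     (fun r => - (1 / Rad ^ 2)
        - B * D ^ 2 * r ^ 2 * (sec (sqrt (- B) * Phi F D Rad r)) ^ 2
        + 2 * sqrt (- B) * D * sec (sqrt (- B) * Phi F D Rad r)
          * csc (sqrt (- B) * Phi F D Rad r) * sqrt (1 - r ^ 2 / Rad ^ 2))) /\
  class_Ib_solution kappa Rad a b (3 / 2) B C
    (fun r => 3 * B ^ 2 * (Phi F D Rad r) ^ 2 - 2 <> 0 /\ Phi F D Rad r <> 0)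
    (fun r => 2 * B ^ 3 * (Phi F D Rad r) ^ 2
              / (3 * B ^ 2 * (Phi F D Rad r) ^ 2 - 2))
    (fun r => 3 * D * B * r ^ 3 / (3 * B ^ 2 * (Phi F D Rad r) ^ 2 - 2))
    (fun r => 3 / Rad ^ 2
       - 9 * B ^ 2 * D ^ 2 * r ^ 2
         / (3 * B ^ 2 * (Phi F D Rad r) ^ 2 - 2) ^ 2)
    (fun r => - (1 / Rad ^ 2)
       + 9 * B ^ 2 * D ^ 2 * r ^ 2
         / (3 * B ^ 2 * (Phi F D Rad r) ^ 2 - 2) ^ 2
       - 4 * D * sqrt (1 - r ^ 2 / Rad ^ 2)
         / ((3 * B ^ 2 * (Phi F D Rad r) ^ 2 - 2) * Phi F D Rad r)).
Proof.
  assert (v2 : sqrt 2 ^ 2 = 2) by (apply pow2_sqrt; lra).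
  assert (v0 := sqrt_lt_R0 2 Rlt_0_2).
  assert (hk : / sqrt 2 * sqrt 2 = 1) by (field; lra).
  assert (hv : sqrt 2 = 2 * / sqrt 2) by (rewrite <- v2 at 2; field; lra).
  assert (div_v : forall x, x / sqrt 2 = / sqrt 2 * x) by (intros; apply Rmult_comm).
  assert (w0 := fun h : 0 < B => sqrt_lt_R0 B h).
  assert (w2 := fun h : 0 < B => pow2_sqrt B (Rlt_le _ _ h)).
  assert (w0' : B < 0 -> 0 < sqrt (- B)) by (intros; apply sqrt_lt_R0; lra).
  assert (w2' : B < 0 -> - sqrt (- B) ^ 2 = B) by (intros; rewrite pow2_sqrt; lra).
  split; [| split; [| split; [| split]]].
  - intros h. specialize (w0 h). specialize (w2 h).
    assert (hp := fun y => profile_cosh (sqrt B) (sqrt 2) (/ sqrt 2) y w0 v0 v2 hk).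
    rewrite w2 in hp.
    refine (class_Ib_of_profile _ _ F _ _ _ _ _ _ 1 _ _ _ _ _ _ _ _ _ _
              ha hab hb hD (or_introl eq_refl) (fun r _ _ _ => conj (hp _) _)).
    rewrite div_v. set (x := Phi F D Rad r). assert (hc := cosh_pos (/ sqrt 2 * x)).
    assert (0 < / sqrt 2) by (apply Rinv_0_lt_compat; auto).
    (* Once sqrt 2 is written as 2 k, the formulas for Q, rho and p are rational identities; only
       exp omega still needs the squares of sqrt 2 and sqrt B. *)
    set (k := / sqrt 2) in *. unfold tanh. rewrite hv. repeat split; try (field; lra).
    rewrite <- hv, !Rpow_mult_distr, v2, w2. ring.
  - intros h. specialize (w0' h). specialize (w2' h).
    refine (class_Ib_of_profile _ _ F _ _ _ _ _ _ 1 _ _ _ _ _ _ _ _ _ _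
              ha hab hb hD (or_introl eq_refl) _).
    intros r _ hs _. rewrite div_v in *.
    assert (hp := profile_sinh (sqrt (- B)) (sqrt 2) (/ sqrt 2) _ w0' v0 v2 hk hs).
    rewrite w2' in hp. split; [exact hp |].
    set (x := Phi F D Rad r) in *.
    assert (0 < / sqrt 2) by (apply Rinv_0_lt_compat; auto).
    set (k := / sqrt 2) in *. unfold coth. rewrite hv. repeat split; try (field; lra).
    rewrite <- hv, !Rpow_mult_distr, v2. rewrite <- w2' at 1. ring.
  - intros h. specialize (w0 h). specialize (w2 h).
    (* The sign is -1 because G'/Z = - sqrt B csch, from the derivative of csch. *)
    refine (class_Ib_of_profile _ _ F _ _ _ _ _ _ (-1) _ _ _ _ _ _ _ _ _ _
              ha hab hb hD (or_intror eq_refl) _).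
    intros r _ hs _.
    assert (hp := profile_coth (sqrt B) _ w0 hs).
    rewrite w2 in hp. split; [exact hp |].
    set (x := Phi F D Rad r) in *. assert (hc := cosh_pos (sqrt B * x)).
    set (w := sqrt B) in *. rewrite <- w2. unfold coth, csch, sech.
    repeat split; field; repeat split; lra.
  - intros h. specialize (w0' h). specialize (w2' h).
    refine (class_Ib_of_profile _ _ F _ _ _ _ _ _ 1 _ _ _ _ _ _ _ _ _ _
              ha hab hb hD (or_introl eq_refl) _).
    intros r _ [hc hs] _.
    assert (hp := profile_tan (sqrt (- B)) _ w0' hc hs).
    rewrite w2' in hp. split; [exact hp |].
    set (x := Phi F D Rad r) in *. set (w := sqrt (- B)) in *.
    rewrite <- w2'. unfold tan, sec, csc.
    repeat split; field; repeat split; lra.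
  (* The sign is -1 because G'/Z = - 3 B / (3 B^2 Phi^2 - 2). *)
  - refine (class_Ib_of_profile _ _ F _ _ _ _ _ _ (-1) _ _ _ _ _ _ _ _ _ _
              ha hab hb hD (or_intror eq_refl) _).
    intros r _ [hE hx] he. set (x := Phi F D Rad r) in *.
    (* The stated exp omega is 2 (B x)^2 times this quotient, so its positivity passes to the
       quotient. *)
    assert (hBE : 0 < B / (3 * B ^ 2 * x ^ 2 - 2)).
    { apply Rmult_lt_reg_l with (2 * (B * x) ^ 2).
      - assert (0 < (B * x) ^ 2); [| lra]. apply pow2_gt_0.
        apply Rmult_integral_contrapositive_currified; auto.
      - rewrite Rmult_0_r.
        replace (2 * (B * x) ^ 2 * (B / (3 * B ^ 2 * x ^ 2 - 2)))
          with (2 * B ^ 3 * x ^ 2 / (3 * B ^ 2 * x ^ 2 - 2)) by (field; auto). auto. }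
    split; [exact (profile_rational B x hBE hx) |]. fold x. cbv beta.
    assert (hG : 0 < sqrt (2 * (B / (3 * B ^ 2 * x ^ 2 - 2)))) by (apply sqrt_lt_R0; lra).
    assert (hG2 := pow2_sqrt (2 * (B / (3 * B ^ 2 * x ^ 2 - 2)))).
    set (G := sqrt (2 * _)) in *. repeat split.
    + replace ((B * x * G) ^ 2) with (B ^ 2 * x ^ 2 * G ^ 2) by ring.
      rewrite hG2; [| lra]. field. auto.
    + field. repeat split; auto; lra.
    + field. repeat split; auto; lra.
    + field. repeat split; auto; lra.
Qed.
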